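(* A completely regular semiring $S$ is a band orthoring if and only if it is a distributive lattice of rectangular rings.
   Context: A semiring $(S,+,\cdot)$ is a set with two associative binary operations such that $x(y+z)=xy+xz$ and $(x+y)z=xz+yz$ (no commutativity assumed). Rings are associative with commutative addition and need not have an identity. A semiring is completely regular if it is a union of subsemirings that are rings. $E^+(S)=\{e\in S\mid e+e=e\}$. An idempotent semiring is a semiring satisfying $x+x=x$ and $x\cdot x=x$. A band semiring is an idempotent semiring satisfying $x+xy+x=x$ and $x+yx+x=x$. A band orthoring is a completely regular semiring $S$ such that $E^+(S)$ is a subsemiring of $S$ and is a band semiring. A rectangular idempotent semiring is an idempotent semiring whose additive reduct is a rectangular band ($x+y+x=x$). A rectangular ring is a semiring that is (isomorphic to) a direct product of a rectangular idempotent semiring and a ring. A distributive lattice is regarded as a semiring (join as $+$, meet as $\cdot$). $S$ is a distributive lattice of rectangular rings if there is a semiring congruence $\rho$ on $S$ such that $S/\rho$ is a distributive lattice and each $\rho$-class is a rectangular ring.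
   Formalization: ''Completely regular'' is read as a disjoint union of subsemirings that are rings; for an arbitrary union the claim fails, e.g. for the additive group S_3 with zero product, a union of cyclic zero-rings with noncommutative addition. *)

(* Defs.v *)
From HB Require Import structures.
From mathcomp Require Import all_boot all_order generic_quotient.
From mathcomp Require Import boolp classical_sets.
Set Implicit Arguments.
Unset Strict Implicit.
Unset Printing Implicit Defensive.
Import Order.TTheory.

Local Open Scope classical_set_scope.

(* The semiring structures of MathComp have commutative addition, a zero and a
   one, none of which is assumed here.  A choiceType carrier is no restriction
   under the axioms of boolp (see gen_choiceMixin); it makes {eq_quot _}
   available.  The carrier may be empty. *)
Record semiring := Semiring {
  carrier :> choiceType;
  sadd : carrier -> carrier -> carrier;
  smul : carrier -> carrier -> carrier;
  saddA : associative sadd;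
  smulA : associative smul;
  smulDr : right_distributive smul sadd;
  smulDl : left_distributive smul sadd
}.

Declare Scope semiring_scope.
Delimit Scope semiring_scope with SR.
Notation "x + y" := (sadd x y) : semiring_scope.
Notation "x * y" := (smul x y) : semiring_scope.
Local Open Scope semiring_scope.

Definition semiring_isomorphic (S T : semiring) : Prop :=
  exists f : S -> T,
    [/\ bijective f, {morph f : x y / x + y} & {morph f : x y / x * y}].

Record subsemiring (S : semiring) (A : set S) : Prop := Subsemiring {
  subsemiringD : forall x y, A x -> A y -> A (x + y);
  subsemiringM : forall x y, A x -> A y -> A (x * y)
}.

Section Sub.
Context (S : semiring) (A : set S) (hA : subsemiring A).

Definition sub_add (x y : A) : A :=
  exist _ (val x + val y)
    (mem_set (subsemiringD hA (set_mem (valP x)) (set_mem (valP y)))).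

Definition sub_mul (x y : A) : A :=
  exist _ (val x * val y)
    (mem_set (subsemiringM hA (set_mem (valP x)) (set_mem (valP y)))).

Fact sub_addA : associative sub_add.
Proof. by move=> x y z; apply: val_inj; rewrite /= saddA. Qed.

Fact sub_mulA : associative sub_mul.
Proof. by move=> x y z; apply: val_inj; rewrite /= smulA. Qed.

Fact sub_mulDr : right_distributive sub_mul sub_add.
Proof. by move=> x y z; apply: val_inj; rewrite /= smulDr. Qed.

Fact sub_mulDl : left_distributive sub_mul sub_add.
Proof. by move=> x y z; apply: val_inj; rewrite /= smulDl. Qed.

Definition sub_semiring : semiring :=
  Semiring sub_addA sub_mulA sub_mulDr sub_mulDl.

End Sub.

Section Prod.
Context (S T : semiring).

Definition prod_add (x y : S * T) : S * T := (x.1 + y.1, x.2 + y.2).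
Definition prod_mul (x y : S * T) : S * T := (x.1 * y.1, x.2 * y.2).

Fact prod_addA : associative prod_add.
Proof. by move=> x y z; rewrite /prod_add /= !saddA. Qed.

Fact prod_mulA : associative prod_mul.
Proof. by move=> x y z; rewrite /prod_mul /= !smulA. Qed.

Fact prod_mulDr : right_distributive prod_mul prod_add.
Proof. by move=> x y z; rewrite /prod_mul /prod_add /= !smulDr. Qed.

Fact prod_mulDl : left_distributive prod_mul prod_add.
Proof. by move=> x y z; rewrite /prod_mul /prod_add /= !smulDl. Qed.

Definition prod_semiring : semiring :=
  Semiring prod_addA prod_mulA prod_mulDr prod_mulDl.

End Prod.

Record congruence (S : semiring) (rho : equiv_rel S) : Prop := Congruence {
  congruenceD : forall x x' y y',
    rho x x' -> rho y y' -> rho (x + y) (x' + y');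
  congruenceM : forall x x' y y',
    rho x x' -> rho y y' -> rho (x * y) (x' * y')
}.

Section Quotient.
Context (S : semiring) (rho : equiv_rel S) (hrho : congruence rho).
Local Open Scope quotient_scope.
Local Notation Q := {eq_quot rho}.

Definition quot_add : Q -> Q -> Q := lift_op2 Q (@sadd S).
Definition quot_mul : Q -> Q -> Q := lift_op2 Q (@smul S).

Fact rho_repr (x : S) : rho (repr (\pi_Q x)) x.
Proof. by apply/(@eqquotP S rho Q); rewrite reprK. Qed.

Fact quot_add_pi x y : quot_add (\pi_Q x) (\pi_Q y) = \pi_Q (x + y).
Proof.
rewrite /quot_add -lock; apply/(@eqquotP S rho Q).
by apply: congruenceD => //; apply: rho_repr.
Qed.

Fact quot_mul_pi x y : quot_mul (\pi_Q x) (\pi_Q y) = \pi_Q (x * y).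
Proof.
rewrite /quot_mul -lock; apply/(@eqquotP S rho Q).
by apply: congruenceM => //; apply: rho_repr.
Qed.

Fact quot_addA : associative quot_add.
Proof.
by move=> a b c; rewrite -[a]reprK -[b]reprK -[c]reprK !quot_add_pi saddA.
Qed.

Fact quot_mulA : associative quot_mul.
Proof.
by move=> a b c; rewrite -[a]reprK -[b]reprK -[c]reprK !quot_mul_pi smulA.
Qed.

Fact quot_mulDr : right_distributive quot_mul quot_add.
Proof.
move=> a b c; rewrite -[a]reprK -[b]reprK -[c]reprK.
by rewrite !(quot_add_pi, quot_mul_pi) smulDr.
Qed.

Fact quot_mulDl : left_distributive quot_mul quot_add.
Proof.
move=> a b c; rewrite -[a]reprK -[b]reprK -[c]reprK.
by rewrite !(quot_add_pi, quot_mul_pi) smulDl.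
Qed.

Definition quot_semiring : semiring :=
  Semiring quot_addA quot_mulA quot_mulDr quot_mulDl.

End Quotient.

Definition lattice_semiring d (L : distrLatticeType d) : semiring :=
  @Semiring L Order.join Order.meet (@joinA d L) (@meetA d L)
    (@meetUr d L) (@meetUl d L).

Definition is_distributive_lattice (S : semiring) : Prop :=
  exists (d : Order.disp_t) (L : distrLatticeType d),
    semiring_isomorphic S (lattice_semiring L).

(* No multiplicative identity is required. *)
Definition is_ring (S : semiring) : Prop :=
  commutative (@sadd S) /\
  exists (zero : S) (opp : S -> S),
    left_id zero (@sadd S) /\ left_inverse zero opp (@sadd S).

(* The union is disjoint.  An arbitrary cover by subrings does not make the
   maximal additive subgroups of S commutative (take a nonabelian group as the
   additive reduct, with the constantly zero product: its cyclic subgroups are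
   subrings), although every rectangular ring has this property. *)
Definition completely_regular (S : semiring) : Prop :=
  exists F : set (set S),
    [/\ forall A, F A -> exists hA : subsemiring A, is_ring (sub_semiring hA),
        trivIset F id
      & \bigcup_(A in F) A = setT].

Definition Eplus (S : semiring) : set S := [set e : S | e + e = e].

Definition idempotent_semiring (S : semiring) : Prop :=
  (forall x : S, x + x = x) /\ (forall x : S, x * x = x).

Definition band_semiring (S : semiring) : Prop :=
  [/\ idempotent_semiring S,
      forall x y : S, x + x * y + x = x
    & forall x y : S, x + y * x + x = x].

Definition band_orthoring (S : semiring) : Prop :=
  completely_regular S /\
  exists hE : subsemiring (@Eplus S), band_semiring (sub_semiring hE).

Definition rectangular_idempotent_semiring (S : semiring) : Prop :=
  idempotent_semiring S /\ (forall x y : S, x + y + x = x).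

Definition rectangular_ring (S : semiring) : Prop :=
  exists I R : semiring,
    [/\ rectangular_idempotent_semiring I, is_ring R
      & semiring_isomorphic S (prod_semiring I R)].

Definition distributive_lattice_of_rectangular_rings (S : semiring) : Prop :=
  exists (rho : equiv_rel S) (hrho : congruence rho),
    is_distributive_lattice (quot_semiring hrho) /\
    forall x : S, exists hx : subsemiring [set y | rho x y],
      rectangular_ring (sub_semiring hx).

(* Main.v *)
Require Import Defs.
From HB Require Import structures.
From mathcomp Require Import all_boot all_order generic_quotient.
From mathcomp Require Import boolp classical_sets.
Set Implicit Arguments.
Unset Strict Implicit.
Unset Printing Implicit Defensive.
Import Order.TTheory.

Local Open Scope classical_set_scope.
Local Open Scope semiring_scope.

(** Write [zero x] for the zero of the ring containing [x].  Distributivity makes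
    [zero] multiplicative, [zero (x * y) = zero x * zero y = zero x * y], so all
    the difficulty lies in the addition, where [zero] need not be a morphism.

    Suppose first that the additive idempotents form a band semiring.  Call [x]
    below [y] when [x = u + y + v] for some [u] and [v], and let [same] be the
    associated equivalence (Green's relation J of the additive reduct).  As for
    every union of groups, [x + y] is a greatest lower bound of [x] and [y], so
    the quotient by [same] is a semilattice under addition; by distributivity
    [same] is also a congruence for multiplication.  Since [x] and [zero x] are
    equivalent, the quotient is determined by the idempotents, and the laws
    [e + e f + e = e] and [e + f e + e = e] become the absorption laws of a
    distributive lattice ([same_quotient_lattice]).  Because sums of idempotents
    are idempotent, equivalent idempotents satisfy [e + f + e = e]
    ([below_sandwich]); hence inside one class an idempotent summand between two
    terms can be erased ([absorb_mid]), and [zero] is additive there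
    ([zeroD_same]).  Fix [x] and put [e = zero x]: the map sending [y] to
    [(zero y, e + y + e)] is an isomorphism from the class of [x] onto the
    product of its idempotents with the ring of all [r] such that [zero r = e];
    its inverse sends [(i, r)] to [i + r + i] ([class_rectangular_ring]).

    Conversely, suppose that [S] is a distributive lattice of rectangular rings.
    In each class the idempotents form a rectangular band, but [e] and [f] may
    lie in different classes.  With [a = e + f] and [g = zero a] one has
    [a = (g + e) + (f + g)], where both summands are idempotents of the class of
    [a]; so [a] is idempotent ([idemD_of_rectangular]).  By absorption in the
    lattice, [e] and [h = e + e f + e] lie in one class, so
    [e = e + h + e = h], and likewise for [f e] in place of [e f]. *)

(** * Distributive lattices as semirings *)

Definition lattice_laws (T : semiring) : Prop :=
  [/\ commutative (@sadd T),
      forall x : T, x * x = x,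
      forall x y : T, x + x * y = x
    & forall x y : T, x + y * x = x].

(** Commutativity of the product comes from the order: a product is bounded by
    both factors, and since multiplication is monotone and idempotent it is their
    greatest lower bound, which does not depend on the order of the factors. *)
Lemma smulC_lattice_laws (T : semiring) :
  lattice_laws T -> commutative (@smul T).
Proof.
case=> addC mulxx absl absr.
have le (x y z : T) : z + x = x -> z + y = y -> z + x * y = x * y.
  move=> zx zy; have zxy : z * y + x * y = x * y by rewrite -smulDl zx.
  have zz : z + z * y = z * y.
    by rewrite -{1}(mulxx z) -smulDr zy.
  by rewrite -zxy saddA zz.
move=> x y; have H (u v : T) : u * v + v * u = v * u.
  by apply: le; rewrite addC ?absr ?absl.
by rewrite -[LHS](H y x) addC H.
Qed.

Section LatticeOfLaws.
Context (T : semiring) (laws : lattice_laws T).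

Fact lattice_laws_addC : commutative (@sadd T). Proof. by case: laws. Qed.

Fact lattice_laws_mulxx : idempotent_op (@smul T). Proof. by case: laws. Qed.

Fact lattice_laws_addKM (y x : T) : x + x * y = x. Proof. by case: laws. Qed.

Fact lattice_laws_mulKD (y x : T) : x * (x + y) = x.
Proof. by rewrite smulDr lattice_laws_mulxx lattice_laws_addKM. Qed.

(** A copy of the carrier indexed by the laws, so that the order structure below
    can be inferred from the type. *)
Definition lattice_carrier of lattice_laws T : Type := T.

HB.instance Definition _ := Choice.on (lattice_carrier laws).
HB.instance Definition _ := Order.isMeetJoinDistrLattice.Build
  (Order.Disp tt tt) (lattice_carrier laws)
  (fun _ _ => erefl) (fun _ _ => erefl)
  (smulC_lattice_laws laws) lattice_laws_addC (@smulA T) (@saddA T)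
  lattice_laws_mulKD lattice_laws_addKM (@smulDl T) lattice_laws_mulxx.

End LatticeOfLaws.

Lemma is_distributive_latticeP (T : semiring) :
  is_distributive_lattice T <-> lattice_laws T.
Proof.
split=> [[d [L [f [fbij fD fM]]]]|laws].
  have finj := bij_inj fbij.
  split=> [x y|x|x y|x y]; apply: finj; rewrite ?(fD, fM) /=.
  - by rewrite joinC.
  - by rewrite meetxx.
  - by rewrite meetKU.
  - by rewrite meetC meetKU.
exists (Order.Disp tt tt), (lattice_carrier laws), id.
by split=> //; exists id.
Qed.

(** * The zero and the opposite of the ring containing an element *)

Definition set_elt (T : Type) (A : set T) x (Ax : A x) : A :=
  exist _ x (mem_set Ax).

(** An equational form of complete regularity, in which the rings are the fibres
    of [zero]; [zero x] and [neg x] are the zero and an additive inverse of [x]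
    in its ring. *)
Record union_of_rings (S : semiring) (zero neg : S -> S) : Prop :=
  UnionOfRings {
    add0s : forall x, zero x + x = x;
    adds0 : forall x, x + zero x = x;
    addsN : forall x, x + neg x = zero x;
    addNs : forall x, neg x + x = zero x;
    zero_mul : forall x, zero x * zero x = zero x;
    zero_addC : forall x y, zero x = zero y -> x + y = y + x
  }.

Lemma ring_idem0 (R : semiring) (o : R) (opp : R -> R) :
  left_id o (@sadd R) -> left_inverse o opp (@sadd R) ->
  forall e, e + e = e -> e = o.
Proof. by move=> o0 oN e ee; rewrite -[LHS]o0 -(oN e) -saddA ee. Qed.

(** Disjointness of the rings is what yields commutativity of addition on the
    fibres of [zero]: elements with the same zero lie in the same ring. *)
Lemma completely_regular_union (S : semiring) :
  completely_regular S -> exists zero neg : S -> S, union_of_rings zero neg.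
Proof.
case=> F [ringF trivF coverF].
have /choice[zn znP] (x : S) : exists p : S * S, exists2 A, F A &
    [/\ A x /\ A p.1, p.1 + x = x /\ x + p.1 = x,
      x + p.2 = p.1 /\ p.2 + x = p.1, p.1 * p.1 = p.1
      & forall y, A y -> x + y = y + x].
  have : (\bigcup_(A in F) A) x by rewrite coverF.
  case=> A FA Ax; have [hA [addC [o [opp [o0 oN]]]]] := ringF A FA.
  pose a : sub_semiring hA := set_elt Ax.
  have oo : smul o o = o by apply: (ring_idem0 o0 oN); rewrite -smulDr o0.
  have v (s t : sub_semiring hA) : s = t -> val s = val t by move=> ->.
  exists (val o, val (opp a)), A => //; split=> /=.
  - by split=> //; apply: set_mem (valP o).
  - by split; [have /v := o0 a | have /v := o0 a; rewrite addC].
  - by split; [have /v := oN a; rewrite addC | have /v := oN a].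
  - by have /v := oo.
  by move=> y Ay; have /v := addC a (set_elt Ay).
exists (fun x => (zn x).1), (fun x => (zn x).2).
split=> [x|x|x|x|x|x y e];
  have [A FA [[Ax Ao] [ox xo] [xN Nx] oo comm]] := znP x => //.
have [B FB [[By Bo] _ _ _ _]] := znP y; apply: comm.
suff -> : A = B by [].
by apply: trivF => //; exists (zn x).1; split=> //; rewrite e.
Qed.

Section UnionOfRings.
Context (S : semiring) (zero neg : S -> S) (hS : union_of_rings zero neg).
Implicit Types (e f g u v w x y : S).

Local Notation add0s := (add0s hS).
Local Notation adds0 := (adds0 hS).
Local Notation addsN := (addsN hS).
Local Notation addNs := (addNs hS).
Local Notation zero_mul := (zero_mul hS).

Lemma zeroD x : zero x + zero x = zero x.
Proof. by rewrite -{2}addsN saddA add0s addsN. Qed.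

(** A one-sided identity together with a one-sided inverse already pins down the
    zero; this is how every value of [zero] below is computed. *)
Lemma zeroE e x y : e + x = x -> y + x = e -> zero x = e.
Proof.
move=> ex yx; have e0 : e + zero x = zero x by rewrite -addsN saddA ex.
by rewrite -e0 -yx -saddA adds0.
Qed.

Lemma zero_idem e : e + e = e -> zero e = e.
Proof. by move=> ee; apply: (zeroE ee ee). Qed.

Lemma zeroK x : zero (zero x) = zero x.
Proof. apply/zero_idem/zeroD. Qed.

Lemma mul_idem e : e + e = e -> e * e = e.
Proof. by move=> /zero_idem <-; apply: zero_mul. Qed.

(** [neg x * y] is an additive inverse of [x * y] relative to [zero x * y]. *)
Lemma zeroM_l x y : zero (x * y) = zero x * y.
Proof.
by apply: (@zeroE _ _ (neg x * y)); rewrite -smulDl ?add0s ?addNs.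
Qed.

Lemma zeroM_r x y : zero (x * y) = x * zero y.
Proof.
by apply: (@zeroE _ _ (x * neg y)); rewrite -smulDr ?add0s ?addNs.
Qed.

Lemma zeroM x y : zero (x * y) = zero x * zero y.
Proof. by rewrite -[LHS]zeroK zeroM_l zeroM_r. Qed.

(** * The least semilattice congruence of the addition *)

(** The preorder of Green's relation J on the additive reduct.  Since
    [x = zero x + x = x + zero x], no case distinction for an empty [u] or [v]
    is necessary. *)
Definition below x y := exists u v, x = u + y + v.

Lemma below_refl x : below x x.
Proof. by exists (zero x), (zero x); rewrite add0s adds0. Qed.

Lemma below_trans y x w : below x y -> below y w -> below x w.
Proof.
move=> [u [v ->]] [u' [v' ->]]; exists (u + u'), (v' + v).
by rewrite !saddA.
Qed.

Lemma below_addl x y : below (x + y) x.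
Proof. by exists (zero x), y; rewrite add0s. Qed.

Lemma below_addr x y : below (x + y) y.
Proof. by exists x, (zero y); rewrite -saddA adds0. Qed.

Lemma below_addxx x : below x (x + x).
Proof. by exists (neg x), (zero x); rewrite saddA addNs add0s adds0. Qed.

(** [x + y] is below its double [x + (y + x) + y]. *)
Lemma below_addC x y : below (x + y) (y + x).
Proof.
by apply: below_trans (below_addxx _) _; exists x, y; rewrite !saddA.
Qed.

(** The double of [w], written with the factorization through [y] first and the
    one through [x] second, contains the segment [y + t + x], which can be
    rotated into [(x + y) + t]. *)
Lemma below_glb w x y : below w x -> below w y -> below w (x + y).
Proof.
move=> [u [v e1]] [u' [v' e2]].
apply: below_trans (below_addxx _) _.
rewrite {1}e2 e1.
have : below (y + (v' + u) + x) (x + y).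
  apply: below_trans (below_addC _ _) _.
  by rewrite saddA; apply: below_addl.
by apply: below_trans; exists u', v; rewrite !saddA.
Qed.

Lemma below_mulr w x y : below x y -> below (x * w) (y * w).
Proof. by move=> [u [v ->]]; exists (u * w), (v * w); rewrite !smulDl. Qed.

Lemma below_mull w x y : below x y -> below (w * x) (w * y).
Proof. by move=> [u [v ->]]; exists (w * u), (w * v); rewrite !smulDr. Qed.

Lemma below_zerol x : below (zero x) x.
Proof. by rewrite -addsN; apply: below_addl. Qed.

Lemma below_zeror x : below x (zero x).
Proof. by rewrite -{1}(add0s x); apply: below_addl. Qed.

Definition same x y := below x y /\ below y x.

Lemma same_refl x : same x x. Proof. by split; apply: below_refl. Qed.

Lemma same_sym x y : same x y -> same y x. Proof. by case. Qed.

Lemma same_trans y x w : same x y -> same y w -> same x w.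
Proof. by move=> [a b] [c d]; split; apply: (@below_trans y). Qed.

Lemma same_zero x : same (zero x) x.
Proof. by split; [apply: below_zerol | apply: below_zeror]. Qed.

Lemma sameD x x' y y' : same x x' -> same y y' -> same (x + y) (x' + y').
Proof.
have H a a' b b' : below a a' -> below b b' -> below (a + b) (a' + b').
  move=> aa' bb'; apply: below_glb.
    by apply: below_trans aa'; apply: below_addl.
  by apply: below_trans bb'; apply: below_addr.
by move=> [? ?] [? ?]; split; apply: H.
Qed.

Lemma sameM x x' y y' : same x x' -> same y y' -> same (x * y) (x' * y').
Proof.
have H a a' b b' : below a a' -> below b b' -> below (a * b) (a' * b').
  by move=> aa' bb'; apply: below_trans (below_mulr _ aa') (below_mull _ bb').
by move=> [? ?] [? ?]; split; apply: H.
Qed.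

Lemma same_addC x y : same (x + y) (y + x).
Proof. by split; apply: below_addC. Qed.

Lemma same_addxx x : same (x + x) x.
Proof. by split; [apply: below_addl | apply: below_addxx]. Qed.

(** The square of [x] lies in the same ring as [x], since [zero] is
    multiplicative. *)
Lemma same_mulxx x : same (x * x) x.
Proof.
apply: same_trans (same_sym (same_zero _)) _.
by rewrite zeroM zero_mul; apply: same_zero.
Qed.

Lemma same_add_below x y : below x y -> same (x + y) x.
Proof.
move=> xy; split; first exact: below_addl.
by apply: below_glb => //; apply: below_refl.
Qed.

Lemma same_addl x y w : same w x -> same w y -> same w (x + y).
Proof.
move=> wx wy; apply: same_trans (sameD wx wy).
exact/same_sym/same_addxx.
Qed.

Definition sameb x y := `[< same x y >].

Fact sameb_refl : reflexive sameb.
Proof. by move=> x; apply/asboolP/same_refl. Qed.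

Fact sameb_sym : symmetric sameb.
Proof. by move=> x y; apply/asboolP/asboolP; apply: same_sym. Qed.

Fact sameb_trans : transitive sameb.
Proof.
by move=> y x w /asboolP xy /asboolP yw; apply/asboolP/(same_trans xy yw).
Qed.

Definition same_equiv : equiv_rel S :=
  EquivRel sameb sameb_refl sameb_sym sameb_trans.

Lemma same_congruence : congruence same_equiv.
Proof.
by split=> x x' y y' /asboolP xx' /asboolP yy'; apply/asboolP;
  [apply: sameD | apply: sameM].
Qed.

(** Every element is equivalent to its zero, so the two laws assumed for
    idempotents place both products of [x] and [y] above [x] for the preorder
    [below], whose lower bounds are sums: these are the absorption laws. *)
Lemma same_quotient_lattice :
  (forall e f, e + e = e -> f + f = f -> e + e * f + e = e) ->
  (forall e f, e + e = e -> f + f = f -> e + f * e + e = e) ->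
  is_distributive_lattice (quot_semiring same_congruence).
Proof.
move=> absl absr; apply/is_distributive_latticeP.
have below_mul x y : below x (x * y) /\ below x (y * x).
  have H e w : zero x + zero w + zero x = zero x -> below x w.
    move=> xwx; apply: below_trans (below_zeror _) _.
    apply: below_trans (below_zerol _).
    by exists (zero x), (zero x); rewrite xwx.
  by split; apply: H; rewrite ?zeroM ?absl ?absr ?zeroD.
have piD := quot_add_pi same_congruence.
have piM := quot_mul_pi same_congruence.
split=> [a b|a|a b|a b]; rewrite -[a]reprK; try rewrite -[b]reprK;
  rewrite /= ?(piD, piM); apply/eqquotP/asboolP.
- exact: same_addC.
- exact: same_mulxx.
- exact/same_add_below/(below_mul _ _).1.
- exact/same_add_below/(below_mul _ _).2.
Qed.

(** * The classes are rectangular rings *)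
Section Orthodox.
Hypothesis idemD : forall e f,
  e + e = e -> f + f = f -> (e + f) + (e + f) = e + f.

(** Write [e = (u + f) + v].  The zero [a0] of [u + f] satisfies [a0 + e = e] and
    [a0 + f = a0], so [e = a0 + (f + e)], and the idempotent [f + e] can be
    doubled at the end of [e], giving [e = e + f + e]. *)
Lemma below_sandwich e f :
  e + e = e -> f + f = f -> below e f -> e + f + e = e.
Proof.
move=> ee ff [u [v euv]].
pose a := u + f; have e_av : e = a + v by [].
have a0e : zero a + e = e by rewrite e_av saddA add0s.
have a0f : zero a + f = zero a.
  by rewrite -addNs /a -!saddA ff.
have e_fe : e = zero a + (f + e) by rewrite saddA a0f a0e.
by rewrite -saddA {1}e_fe -saddA idemD.
Qed.

Lemma same_sandwich e f : e + e = e -> f + f = f -> same e f -> e + f + e = e.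
Proof. by move=> ee ff [ef _]; apply: below_sandwich. Qed.

(** Within a class, an idempotent standing inside a sum disappears: replacing [x]
    by [zero x + x] reduces this to the rectangular band of idempotents of the
    class, where a sum depends only on its two outer terms. *)
Lemma absorb_l e f x : e + e = e -> f + f = f -> same e x -> same f x ->
  e + f + x = e + x.
Proof.
move=> ee ff ex fx; set g := zero x.
have [gg ge] : g + g = g /\ same g e.
  by split; [apply: zeroD | apply: same_trans (same_zero _) (same_sym ex)].
have efg : same e (f + g).
  apply: same_addl; first by apply: same_trans ex (same_sym fx).
  exact: same_sym.
rewrite -(add0s x) -/g !saddA; congr (_ + x).
rewrite -{1}(same_sandwich gg ee ge) !saddA.
by rewrite -(saddA e f g) same_sandwich // idemD.
Qed.

Lemma absorb_r e f x : e + e = e -> f + f = f -> same e x -> same f x ->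
  x + f + e = x + e.
Proof.
move=> ee ff ex fx; set g := zero x.
have [gg ge] : g + g = g /\ same g e.
  by split; [apply: zeroD | apply: same_trans (same_zero _) (same_sym ex)].
have efg : same e (g + f).
  apply: same_addl; first exact: same_sym.
  by apply: same_trans ex (same_sym fx).
rewrite -(adds0 x) -/g -!saddA; congr (x + _).
rewrite -{1}(same_sandwich gg ee ge) -!saddA.
by rewrite (saddA g f e) (saddA e) same_sandwich // idemD.
Qed.

Lemma absorb_sandwich e f x : e + e = e -> f + f = f ->
  same e x -> same f x -> e + (f + x + f) + e = e + x + e.
Proof.
move=> ee ff ex fx; rewrite !saddA (absorb_l ee ff ex fx) (absorb_r ee ff) //.
  by apply: same_addl => //; apply: same_refl.
by apply: same_addl => //; apply: same_trans fx (same_sym ex).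
Qed.

Lemma absorb_mid e x y : e + e = e -> same e x -> same e y ->
  x + e + y = x + y.
Proof.
move=> ee ex ey; rewrite -(adds0 x) -2!saddA (saddA (zero x)).
have zx : same (zero x) y.
  exact: same_trans (same_zero _) (same_trans (same_sym ex) ey).
by rewrite absorb_l ?zeroD // -saddA.
Qed.

(** In a class, [zero] is additive: with [e = zero x] and [f = zero y], the sum
    [e + f] acts as an identity on [x + y], and the opposites added in reverse
    order give an inverse once padded with [e] and [f]. *)
Lemma zeroD_same x y : same x y -> zero (x + y) = zero x + zero y.
Proof.
move=> xy; set e := zero x; set f := zero y.
have ee : e + e = e by apply: zeroD.
have ff : f + f = f by apply: zeroD.
have ex : same e x := same_zero x.
have fy : same f y := same_zero y.
have ef : same e f := same_trans ex (same_trans xy (same_sym fy)).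
apply: (@zeroE _ _ (e + f + neg y + f + neg x)).
  rewrite -[in LHS](add0s x) -/e !saddA.
  by rewrite same_sandwich // /e add0s.
rewrite !saddA -(saddA _ (neg x)) addNs -/e.
have -> : e + f + neg y + f + e + y = e + f + neg y + (f + e + f) + y.
  by rewrite -!saddA add0s.
rewrite same_sandwich //; last exact: same_sym.
by rewrite -!saddA add0s addNs ff.
Qed.

Lemma zero_sandwich e x : e + e = e -> same e x -> zero (e + x + e) = e.
Proof.
move=> ee ex; have exe : same e (e + x).
  by apply: same_addl => //; apply: same_refl.
rewrite zeroD_same; last exact: same_sym.
rewrite zeroD_same // zero_idem // same_sandwich ?zeroD //.
by apply: same_trans ex _; apply/same_sym/same_zero.
Qed.

Fact class_subsemiring x : subsemiring [set y | same_equiv x y].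
Proof.
split=> y w /asboolP xy /asboolP xw; apply/asboolP.
  exact: same_addl.
by apply: same_trans (sameM xy xw); apply/same_sym/same_mulxx.
Qed.

Definition class_idempotents x : set S := [set e | same x e /\ e + e = e].

Fact class_idempotents_subsemiring x : subsemiring (class_idempotents x).
Proof.
split=> e f [xe ee] [xf ff]; split.
- exact: same_addl.
- exact: idemD.
- by apply: same_trans (sameM xe xf); apply/same_sym/same_mulxx.
- by rewrite -smulDr ff.
Qed.

Definition zero_class x : set S := [set y | zero y = zero x].

Lemma zero_class_same x y : zero_class x y -> same x y.
Proof.
move=> /= yx; apply: same_trans (same_sym (same_zero _)) _.
by rewrite -yx; apply: same_zero.
Qed.

Fact zero_class_subsemiring x : subsemiring (zero_class x).
Proof.
split=> y w; rewrite /zero_class /= => yx wx.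
  rewrite zeroD_same ?yx ?wx ?zeroD //.
  exact: same_trans (same_sym (zero_class_same yx)) (zero_class_same wx).
by rewrite zeroM yx wx zero_mul.
Qed.

(** [neg y] is only known to be an inverse of [y]; padding it with [zero y] brings
    it into the fibre of [zero]. *)
Lemma zero_class_ring x : is_ring (sub_semiring (zero_class_subsemiring x)).
Proof.
split.
  move=> [y yx] [w wx]; apply: val_inj; apply: (zero_addC hS).
  by rewrite (set_mem yx) (set_mem wx).
have z0 : zero_class x (zero x) by apply: zeroK.
have zN y : zero_class x y -> zero_class x (zero y + neg y + zero y).
  rewrite /zero_class /= => <-; apply: (@zeroE _ _ y); rewrite !saddA ?zeroD //.
  by rewrite adds0 addsN zeroD.
exists (set_elt z0).
exists (fun y : zero_class x => set_elt (zN _ (set_mem (valP y)))).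
split=> -[y yx]; apply: val_inj => /=.
  by rewrite -(set_mem yx) add0s.
by rewrite -saddA add0s -saddA addNs zeroD -(set_mem yx).
Qed.

Fact class_components x y : same x y ->
  class_idempotents x (zero y) /\ zero_class x (zero x + y + zero x).
Proof.
move=> xy; split; first split.
- exact/(same_trans xy)/same_sym/same_zero.
- exact: zeroD.
- by apply: zero_sandwich; [apply: zeroD | apply: same_trans (same_zero _) xy].
Qed.

(** The idempotent coordinate of [y] is [zero y]; the ring coordinate compresses
    [y] by [e = zero x] into the ring with zero [e].  Both coordinates preserve
    sums because inner idempotents disappear.  For products, expanding
    [(e + y + e) * (e + w + e)] leaves only [y * w] surrounded by idempotents,
    the outer ones being [e]. *)
Lemma class_rectangular_ring x :
  rectangular_ring (sub_semiring (class_subsemiring x)).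
Proof.
set e := zero x.
have ee : e + e = e by apply: zeroD.
have ex : same e x := same_zero x.
pose C := [set y | same_equiv x y].
have CP (y : C) : same x (val y) by apply/asboolP; apply: set_mem (valP y).
exists (sub_semiring (class_idempotents_subsemiring x)).
exists (sub_semiring (zero_class_subsemiring x)).
split; last 1 first.
- pose to (y : C) : class_idempotents x * zero_class x :=
    (set_elt (class_components (CP y)).1,
     set_elt (class_components (CP y)).2).
  exists to; split.
  + have back (p : class_idempotents x * zero_class x) :
        C (val p.1 + val p.2 + val p.1).
      have [xi _] := set_mem (valP p.1).
      have xr := zero_class_same (set_mem (valP p.2)).
      by apply/asboolP/same_addl => //; apply: same_addl.
    exists (fun p => set_elt (back p)).
      move=> y; apply: val_inj => /=; rewrite -/e.
      have xy := CP y; set f := zero (val y).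
      have fy : same f (val y) := same_zero _.
      have ey : same e (val y) := same_trans ex xy.
      by rewrite absorb_sandwich ?zeroD // /f add0s adds0.
    move=> [i r]; have [xi ii] := set_mem (valP i).
    have rx : zero (val r) = e := set_mem (valP r).
    have xr := zero_class_same (set_mem (valP r)).
    have ir : same (val i) (val r) := same_trans (same_sym xi) xr.
    have er : same e (val r) := same_trans ex xr.
    congr pair; apply: val_inj => /=; first exact: zero_sandwich.
    by rewrite -/e absorb_sandwich // -rx add0s adds0.
  + move=> y w; have xy := CP y; have xw := CP w.
    have yw := same_trans (same_sym xy) xw.
    congr pair; apply: val_inj => /=; first exact: zeroD_same.
    rewrite -/e -!saddA (saddA e e) ee !saddA; congr (_ + e).
    rewrite -!saddA; congr (e + _); rewrite saddA absorb_mid //.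
      exact: same_trans ex xy.
    exact: same_trans ex xw.
  + move=> y w; have xy := CP y; have xw := CP w.
    congr pair; apply: val_inj => /=; first exact: zeroM.
    rewrite -/e; set p := e + val y + e.
    (* A product with an idempotent only depends on the zero of the other
       factor, and p lies in the ring with zero e. *)
    have pe : p * e = e.
      rewrite -{1}(zero_idem ee) -zeroM_r zeroM (zero_idem ee).
      by rewrite /p zero_sandwich ?mul_idem //; apply: same_trans ex xy.
    have eyw : same e (val y * val w).
      apply: same_trans (same_sym (same_mulxx _)) _.
      by apply: sameM; [apply: same_trans ex xy | apply: same_trans ex xw].
    have hh : e * val w + e * val w = e * val w by rewrite -smulDl ee.
    have hyw : same (e * val w) (val y * val w).
      by apply: sameM; [apply: same_trans ex xy | apply: same_refl].
    by rewrite !smulDr pe /p !smulDl absorb_sandwich.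
- split; first split.
  + by move=> i; apply: val_inj; have [_ ii] := set_mem (valP i).
  + by move=> i; apply: val_inj; have [_ /mul_idem] := set_mem (valP i).
  + move=> i j; apply: val_inj.
    have [xi ii] := set_mem (valP i); have [xj jj] := set_mem (valP j).
    by apply: same_sandwich => //; apply: same_trans (same_sym xi) xj.
- exact: zero_class_ring.
Qed.

End Orthodox.
End UnionOfRings.

(** * Lattices of rectangular rings are band orthorings *)
Section LatticeOfRectangularRings.
Context (S : semiring) (zero neg : S -> S) (hS : union_of_rings zero neg).
Context (T : semiring) (pi : S -> T).
Hypothesis laws : lattice_laws T.
Hypotheses (piD : {morph pi : x y / x + y}) (piM : {morph pi : x y / x * y}).
Hypothesis rect : forall e f : S, pi e = pi f -> e + e = e -> f + f = f ->
  (e + f) + (e + f) = e + f /\ e + f + e = e.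

Let addC : commutative (@sadd T). Proof. by case: laws. Qed.

Let addxx (a : T) : a + a = a.
Proof. by case: laws => _ mulxx absl _; rewrite -{2}(mulxx a) absl. Qed.

Lemma pi_zero (x : S) : pi (zero x) = pi x.
Proof.
have xN : pi (zero x) = pi x + pi (neg x) by rewrite -(addsN hS) piD.
rewrite -[in RHS](add0s hS x) piD xN.
by rewrite [RHS]addC saddA addxx.
Qed.

(** With [g = zero (e + f)] one has [e + g = g = g + f], which makes [g + e] and
    [f + g] idempotent.  Both lie in the class of [e + f], and their sum is
    [g + (e + f) + g = e + f]; so the assumption on a single class applies, even
    though [e] and [f] may lie in different classes. *)
Lemma idemD_of_rectangular (e f : S) :
  e + e = e -> f + f = f -> (e + f) + (e + f) = e + f.
Proof.
move=> ee ff; set a := e + f.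
have [g gE] : exists g, g = zero a by exists (zero a).
have gg : g + g = g by rewrite gE; apply: (zeroD hS).
have ga : g + a = a by rewrite gE (add0s hS).
have ag : a + g = a by rewrite gE (adds0 hS).
have eg : e + g = g by rewrite gE -(addsN hS) /a !saddA ee.
have gf : g + f = g by rewrite gE -(addNs hS) /a -!saddA ff.
have pig : pi g = pi e + pi f by rewrite gE pi_zero piD.
have ge2 : (g + e) + (g + e) = g + e.
  by rewrite saddA -(saddA g e g) eg gg.
have fg2 : (f + g) + (f + g) = f + g.
  by rewrite saddA -(saddA f g f) gf -saddA gg.
have pige : pi (g + e) = pi (f + g).
  rewrite !piD pig (addC _ (pi e)) saddA addxx.
  by rewrite [RHS]addC -saddA addxx.
have aE : (g + e) + (f + g) = a.
  by rewrite saddA -(saddA g e f) -/a ga ag.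
by have [] := rect pige ge2 fg2; rewrite aE.
Qed.

(** The idempotent [h = e + w + e] lies in the class of [e], so [e + h + e = e],
    whereas [e + h + e = h] because [e] is idempotent. *)
Lemma sandwich_of_rectangular (e w : S) :
  e + e = e -> w + w = w -> pi e + pi w = pi e -> e + w + e = e.
Proof.
move=> ee ww ew; set h := e + w + e.
have hh : h + h = h.
  by apply: idemD_of_rectangular => //; apply: idemD_of_rectangular.
have pih : pi e = pi h by rewrite /h !piD ew addxx.
by have [_] := rect pih ee hh; rewrite /h !saddA ee -!saddA ee.
Qed.

Lemma band_semiring_of_lattice :
  exists hE : subsemiring (@Eplus S), band_semiring (sub_semiring hE).
Proof.
case: laws => _ _ absl absr.
have hE : subsemiring (@Eplus S).
  split=> e f ee ff; first exact: idemD_of_rectangular.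
  by rewrite /Eplus /= -smulDr ff.
have EM (e f : S) : f + f = f -> e * f + e * f = e * f by rewrite -smulDr => ->.
exists hE; split; first split.
- by move=> e; apply: val_inj; apply: set_mem (valP e).
- by move=> e; apply: val_inj; apply/(mul_idem hS)/(set_mem (valP e)).
- move=> e f; apply: val_inj; have ee := set_mem (valP e).
  have ff := set_mem (valP f).
  by apply: sandwich_of_rectangular; rewrite ?piM ?absl //; apply: EM.
- move=> e f; apply: val_inj; have ee := set_mem (valP e).
  have ff := set_mem (valP f).
  by apply: sandwich_of_rectangular; rewrite ?piM ?absr //; apply: EM.
Qed.

End LatticeOfRectangularRings.

(** In a product of a rectangular band with a ring, the ring component of an
    idempotent is zero. *)
Lemma rectangular_ring_idem (S : semiring) :
  rectangular_ring S -> forall e f : S, e + e = e -> f + f = f ->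
  (e + f) + (e + f) = e + f /\ e + f + e = e.
Proof.
case=> I [R [[[Ixx _] Irect] [_ [o [opp [o0 oN]]]] [t [tbij tD _]]]] e f ee ff.
have tinj := bij_inj tbij.
have t2 g : g + g = g -> (t g).2 = o.
  by move=> gg; apply: (ring_idem0 o0 oN); rewrite -{3}gg tD.
split; apply: tinj; rewrite !tD [RHS]surjective_pairing /= /prod_add /= !t2 //;
  by rewrite !o0 ?Ixx ?Irect.
Qed.

Theorem theorem4p2 (S : semiring) (hS : completely_regular S) :
  band_orthoring S <-> distributive_lattice_of_rectangular_rings S.
Proof.
have [zero [neg hU]] := completely_regular_union hS.
split=> [[_ [hE [[_ _] absl absr]]]|[rho [hrho [lat rectC]]]].
  pose E (e : S) (ee : e + e = e) : sub_semiring hE := @set_elt S (@Eplus S) e ee.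
  have idemD (e f : S) : e + e = e -> f + f = f -> e + f + (e + f) = e + f.
    by move=> ee ff; apply: (subsemiringD hE).
  exists (same_equiv hU), (same_congruence hU); split.
    apply: same_quotient_lattice => e f ee ff.
      exact: (congr1 val (absl (E e ee) (E f ff))).
    exact: (congr1 val (absr (E e ee) (E f ff))).
  by move=> x; exists (class_subsemiring hU x); apply: class_rectangular_ring.
split=> //.
apply: (@band_semiring_of_lattice _ _ _ hU (quot_semiring hrho)
  (\pi_{eq_quot rho}%qT)).
- exact/is_distributive_latticeP.
- by move=> x y; rewrite -(quot_add_pi hrho).
- by move=> x y; rewrite -(quot_mul_pi hrho).
move=> e f /eqquotP ef ee ff; have [hx /rectangular_ring_idem rect] := rectC e.
have re : [set y | rho e y] e by apply: equiv_refl.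
have rf : [set y | rho e y] f := ef.
pose e' : sub_semiring hx := set_elt re.
pose f' : sub_semiring hx := set_elt rf.
have [|| d s] := rect e' f'; try exact: val_inj.
by split; [exact: (congr1 val d) | exact: (congr1 val s)].
Qed.
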